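(* Let $G$ be a planar bipartite graph with maximum degree $\Delta$, and let $H$ be a subgraph of $G$ with maximum degree at most $d$. Then any total-$(\Delta+d+4)$-coloring of $H$ in $G$ can be extended to a total-$(\Delta+d+4)$-coloring of $G$.
   Context: All graphs are simple. A total-$k$-coloring of a graph is an assignment of colors from $\{1,\dots,k\}$ to its vertices and edges such that adjacent vertices receive different colors, edges sharing an endpoint receive different colors, and no edge receives the same color as either of its endpoints. For a subgraph $H$ of $G$, a total-$k$-coloring $\varphi$ of $H$ is a total-$k$-coloring of $H$ in $G$ if, in addition, $\varphi(u)\neq\varphi(v)$ for all $u,v\in V(H)$ adjacent in $G$. Extending $\varphi$ to $G$ means finding a total-$k$-coloring of $G$ that agrees with $\varphi$ on all vertices and edges of $H$. *)

(* Defs.v *)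
From Stdlib Require Import Reals.
From mathcomp Require Import all_boot.
Set Implicit Arguments. Unset Strict Implicit. Unset Printing Implicit Defensive.

Definition simple_graph (T : finType) (e : rel T) : Prop :=
  symmetric e /\ irreflexive e.

Definition deg (T : finType) (e : rel T) (v : T) : nat := #|[set u | e v u]|.

Definition maxdeg (T : finType) (e : rel T) : nat := \max_(v : T) deg e v.

Definition bipartite (T : finType) (e : rel T) : Prop :=
  exists part : T -> bool, forall u v, e u v -> part u != part v.

(* Planarity: a drawing in R^2 with vertices at distinct points and each edge
   uv a Jordan arc (continuous, injective on [0,1]) from u to v, the arc of vu
   being the reverse of the arc of uv; arc interiors avoid all vertex points
   and interiors of distinct edges are disjoint. *)
Definition planar (T : finType) (e : rel T) : Prop :=
  exists (px py : T -> R) (ax ay : T -> T -> R -> R),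
    (forall u v, px u = px v -> py u = py v -> u = v) /\
    (forall u v, e u v -> forall t : R, (Rle R0 t) -> (Rle t R1) ->
        continuity_pt (ax u v) t /\ continuity_pt (ay u v) t) /\
    (forall u v, e u v ->
        ax u v R0 = px u /\ ay u v R0 = py u /\
        ax u v R1 = px v /\ ay u v R1 = py v) /\
    (forall u v, e u v -> forall t : R,
        ax v u t = ax u v (Rminus R1 t) /\ ay v u t = ay u v (Rminus R1 t)) /\
    (forall u v, e u v -> forall t : R, (Rlt R0 t) -> (Rlt t R1) ->
        forall w, ~ (ax u v t = px w /\ ay u v t = py w)) /\
    (forall u v x y, e u v -> e x y -> forall t s : R,
        (Rlt R0 t) -> (Rlt t R1) -> (Rlt R0 s) -> (Rlt s R1) ->
        ax u v t = ax x y s -> ay u v t = ay x y s ->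
        (u = x /\ v = y /\ t = s) \/ (u = y /\ v = x /\ t = (Rminus R1 s))).

Definition subgraph (T : finType) (e : rel T) (VH : {set T}) (eH : rel T) : Prop :=
  symmetric eH /\ (forall u v, eH u v -> [/\ u \in VH, v \in VH & e u v]).

Definition maxdeg_le (T : finType) (VH : {set T}) (eH : rel T) (d : nat) : Prop :=
  forall v, v \in VH -> #|[set u in VH | eH v u]| <= d.

Definition in_palette (k c : nat) : bool := (1 <= c <= k).

Definition total_coloring (T : finType) (e : rel T) (k : nat)
    (col : T -> nat) (cole : T -> T -> nat) : Prop :=
  (forall v, in_palette k (col v)) /\
  (forall u v, e u v -> in_palette k (cole u v) /\ cole u v = cole v u) /\
  (forall u v, e u v -> col u != col v) /\
  (forall u v w, e u v -> e u w -> v != w -> cole u v != cole u w) /\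
  (forall u v, e u v -> cole u v != col u).

Definition total_coloring_in (T : finType) (e : rel T) (VH : {set T}) (eH : rel T)
    (k : nat) (col : T -> nat) (cole : T -> T -> nat) : Prop :=
  (forall v, v \in VH -> in_palette k (col v)) /\
  (forall u v, eH u v -> in_palette k (cole u v) /\ cole u v = cole v u) /\
  (forall u v, u \in VH -> v \in VH -> e u v -> col u != col v) /\
  (forall u v w, eH u v -> eH u w -> v != w -> cole u v != cole u w) /\
  (forall u v, eH u v -> cole u v != col u).

(* Main.v *)
(** Colour the vertices outside [H] greedily.  An edge [uv] outside [H] then keeps at least
    [Delta + d + 2 - h(u) - h(v)] admissible colours, where [h <= d] is the degree in [H];
    this is at least the larger of the degrees of [u] and [v] in [G - E(H)].  So it suffices
    that a bipartite multigraph is edge-choosable from lists of size [max (deg u, deg v)]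
    (Borodin, Kostochka and Woodall).  As in Galvin's theorem, stable matchings reduce this to
    ranking the edges at every vertex so that each edge [uv] has fewer than
    [max (deg u, deg v)] better neighbours.  Such rankings are built by repeatedly removing a
    matching, ranked best at its ends on one side and worst at its ends on the other; this
    costs an edge one unit only when its maximal end degree also drops, provided that an
    uncovered neighbour of a best end always has smaller degree than that end. *)

Require Import Defs.
From Stdlib Require Import Reals.
From mathcomp Require Import all_boot zify.
Set Implicit Arguments. Unset Strict Implicit. Unset Printing Implicit Defensive.

(* A bipartite multigraph is a finite type [E] of edges with end maps [l] and [r]; its two
   sides are exchanged by exchanging [l] and [r]. *)
Definition matching (E A B : finType) (l : E -> A) (r : E -> B) (M : {set E}) : Prop :=
  {in M &, injective l} /\ {in M &, injective r}.

Definition incident (E V : finType) (p : E -> V) (F : {set E}) (v : V) : {set E} :=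
  [set x in F | p x == v].

Definition nbrs (E A B : finType) (l : E -> A) (r : E -> B) (F : {set E})
    (X : {set A}) : {set B} :=
  r @: [set x in F | l x \in X].

Definition strict_rank (E V : finType) (p : E -> V) (rk : E -> nat) (F : {set E}) : Prop :=
  {in F &, forall x y, p x = p y -> rk x = rk y -> x = y}.

(* Smaller rank means more preferred. *)
Definition better (E V : finType) (p : E -> V) (rk : E -> nat) (F : {set E}) (x : E) :
    {set E} :=
  [set y in F | (p y == p x) && (rk y < rk x)].

(** * Matchings: Hall, stable matchings, Mendelsohn-Dulmage *)

(* Rado's argument: when two edges share a left end, one of them can be deleted without
   violating Hall's condition, by submodularity of the neighbourhood size. *)
Lemma hall (E A B : finType) (l : E -> A) (r : E -> B) (F : {set E}) (S : {set A}) :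
  (forall X : {set A}, X \subset S -> #|X| <= #|nbrs l r F X|) ->
  exists M : {set E}, [/\ M \subset F, matching l r M & l @: M = S].
Proof.
have [n] := ubnP #|F|; elim: n F => // n IHn F ltFn hallF.
have [/existsP[x /existsP[y /and5P[xF yF lxS /eqP lxy neq_xy]]] | noxy] :=
  boolP [exists x, exists y, [&& x \in F, y \in F, l x \in S, l x == l y & x != y]].
  have del z : z \in F -> (forall X : {set A}, X \subset S ->
        #|X| <= #|nbrs l r (F :\ z) X|) ->
      exists M : {set E}, [/\ M \subset F, matching l r M & l @: M = S].
    move=> zF /IHn[|M [sMF mM lM]]; first by move: ltFn; rewrite (cardsD1 z F) zF; lia.
    by exists M; split=> //; apply: subset_trans sMF (subD1set _ _).
  (* A set that violates Hall's condition once [z] is deleted contains [l z], since otherwise its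
     neighbourhood is unchanged. *)
  have bad z : (forall X : {set A}, X \subset S -> #|X| <= #|nbrs l r (F :\ z) X|) \/
      exists X : {set A}, [/\ X \subset S, l z \in X & #|nbrs l r (F :\ z) X| < #|X|].
    have [/forall_inP allX | ] := boolP [forall (X : {set A} | X \subset S),
      #|X| <= #|nbrs l r (F :\ z) X|]; first by left.
    rewrite negb_forall_in => /exists_inP[X sXS]; rewrite -ltnNge => ltX.
    right; exists X; split=> //; apply: contraLR ltX => lzX.
    rewrite -leqNgt; apply: leq_trans (hallF X sXS) _; apply: subset_leq_card.
    apply/imsetS/subsetP => u; rewrite !inE => /andP[uF luX]; rewrite uF luX !andbT.
    by apply: contraNneq lzX => <-.
  have [/(del x xF)//|[X1 [sX1 lx1 lt1]]] := bad x.
  have [/(del y yF)//|[X2 [sX2 ly2 lt2]]] := bad y.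
  rewrite -lxy in ly2.
  set N1 := nbrs l r _ X1 in lt1; set N2 := nbrs l r _ X2 in lt2.
  (* [N1] lacks only the edge [x] and [N2] only [y]; their common left end lies in both [X1] and
     [X2], so each edge still counts in the other set. *)
  have leU : #|X1 :|: X2| <= #|N1 :|: N2|.
    apply: leq_trans (hallF _ _) _; first by rewrite subUset sX1.
    apply/subset_leq_card/subsetP => _ /imsetP[z /[!inE] /andP[zF lz] ->].
    have [zx|nzx] := eqVneq z x.
      by apply/orP; right; apply: imset_f; rewrite !inE zx neq_xy xF ly2.
    have [zy|nzy] := eqVneq z y.
      by apply/orP; left; apply: imset_f; rewrite !inE zy eq_sym neq_xy yF -lxy lx1.
    by case/orP: lz => lz; apply/orP; [left|right]; apply: imset_f; rewrite !inE ?nzx ?nzy zF.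
  have leI : #|(X1 :&: X2) :\ l x| <= #|N1 :&: N2|.
    apply: leq_trans (hallF _ _) _.
      by apply: subset_trans (subD1set _ _) (subset_trans (subsetIl _ _) sX1).
    apply/subset_leq_card/subsetP => _ /imsetP[z /[!inE] /and4P[zF nz z1 z2] ->].
    have nzx : z != x by apply: contraNneq nz => ->.
    have nzy : z != y by apply: contraNneq nz => ->; rewrite lxy.
    by apply/andP; split; apply: imset_f; rewrite !inE ?nzx ?nzy zF ?z1 ?z2.
  (* Contradiction: [#|X1| + #|X2| - 1 <= #|N1| + #|N2| <= #|X1| + #|X2| - 2]. *)
  have := cardsUI X1 X2; have := cardsUI N1 N2.
  rewrite (cardsD1 (l x) (X1 :&: X2)) !inE lx1 ly2 /=; lia.
have uniq_l x y : x \in F -> y \in F -> l x \in S -> l x = l y -> x = y.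
  move=> xF yF lxS lxy; apply/eqP; apply: contraNT noxy => nxy.
  by apply/existsP; exists x; apply/existsP; exists y; rewrite xF yF lxS lxy eqxx.
(* With one edge per vertex of [S], Hall's condition on pairs gives injectivity on the right. *)
exists [set x in F | l x \in S]; split.
- by apply/subsetP => x /[!inE] /andP[].
- split=> x y /[!inE] /andP[xF xS] /andP[yF yS]; first exact: uniq_l.
  move=> rxy; have [/(uniq_l _ _ xF yF xS)//|nl] := eqVneq (l x) (l y).
  have := hallF [set l x; l y]; rewrite subUset !sub1set xS yS cards2 nl => /(_ isT).
  suff /subset_leq_card : nbrs l r F [set l x; l y] \subset [set r x].
    by rewrite cards1 => le1 /leq_trans/(_ le1).
  apply/subsetP=> _ /imsetP[z /[!inE] /andP[zF /orP[]/eqP zl] ->].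
    by rewrite (uniq_l x z) ?eqxx.
  by rewrite rxy (uniq_l y z) ?eqxx.
apply/setP=> a; apply/imsetP/idP => [[x /[!inE] /andP[_ ?] ->//]|aS].
have := hallF [set a]; rewrite sub1set cards1 => /(_ aS) /card_gt0P[b /imsetP[x /[!inE]]].
by case/andP=> xF /eqP lx _; exists x; rewrite ?inE ?xF lx.
Qed.

(* If two edges that are best at their left ends meet on the right, delete the worse one:
   whatever dominates the better one dominates it too. *)
Lemma stable_matching (E A B : finType) (l : E -> A) (r : E -> B) (rl rr : E -> nat)
    (F : {set E}) :
  strict_rank l rl F -> strict_rank r rr F ->
  exists M : {set E}, [/\ M \subset F, matching l r M &
    forall x, x \in F -> x \notin M ->
      exists2 y, y \in M & (y \in better l rl F x) || (y \in better r rr F x)].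
Proof.
have [n] := ubnP #|F|; elim: n F => // n IHn F ltFn stl str.
pose P := [set x in F | better l rl F x == set0].
have favP x y : x \in P -> y \in F -> l y = l x -> rl x <= rl y.
  rewrite inE => /andP[_ /eqP/setP/(_ y)]; rewrite !inE => + yF lyx.
  by rewrite yF lyx eqxx /= => ltF; rewrite leqNgt ltF.
have sPF : P \subset F by apply/subsetP => x /[!inE] /andP[].
have [/existsP[x /existsP[y /and4P[xP yP /eqP rxy ltxy]]] | noxy] :=
  boolP [exists x, exists y, [&& x \in P, y \in P, r x == r y & rr x < rr y]].
  have xF := subsetP sPF _ xP; have yF := subsetP sPF _ yP.
  have nxy : x != y by apply: contraTneq ltxy => ->; rewrite ltnn.
  have sF : F :\ y \subset F := subD1set _ _.
  have ltF : #|F :\ y| < n by move: ltFn; rewrite (cardsD1 y F) yF; lia.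
  have [||M [sM mM domM]] := IHn _ ltF.
  - by move=> u v /(subsetP sF) uF /(subsetP sF) vF; apply: stl.
  - by move=> u v /(subsetP sF) uF /(subsetP sF) vF; apply: str.
  exists M; split=> //; first exact: subset_trans sM sF.
  move=> z zF zM; have [->|nzy] := eqVneq z y; last first.
    have [|u uM /[!inE] dom] := domM z _ zM; first by rewrite !inE nzy.
    by exists u => //; rewrite !inE; move: dom; case: (u == y); case: (u \in F).
  have [xM|nxM] := boolP (x \in M); first by exists x; rewrite // !inE xF rxy ltxy eqxx orbT.
  have [|u uM /[!inE]] := domM x _ nxM; first by rewrite !inE nxy.
  case/orP=> /andP[/andP[nuy uF] /andP[/eqP lu ltu]].
    by have := favP _ _ xP uF lu; rewrite leqNgt ltu.
  by exists u => //; rewrite !inE uF lu rxy eqxx (ltn_trans ltu ltxy) orbT.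
exists P; split=> //.
  split=> x y xP yP; have [xF yF] := (subsetP sPF _ xP, subsetP sPF _ yP).
    move=> lxy; apply: (stl) => //; apply/eqP; rewrite eqn_leq.
    by rewrite (favP _ _ xP yF) ?(favP _ _ yP xF).
  have nlt u v : u \in P -> v \in P -> r u = r v -> rr v <= rr u.
    move=> uP vP ruv; rewrite leqNgt; apply: contra noxy => lt.
    by apply/existsP; exists u; apply/existsP; exists v; rewrite uP vP ruv eqxx.
  by move=> rxy; apply: (str) => //; apply/eqP; rewrite eqn_leq !nlt.
move=> x xF nxP.
have [|y /andP[yF /eqP lyx] ymin] :=
  @arg_minnP _ x (fun y => (y \in F) && (l y == l x)) rl; first by rewrite xF eqxx.
have yP : y \in P.
  rewrite inE yF; apply/eqP/setP => z; rewrite !inE; apply/negP => /and3P[zF /eqP lz].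
  by rewrite ltnNge ymin // zF lz lyx eqxx.
exists y => //; rewrite !inE yF lyx eqxx /= ltn_neqAle ymin ?xF ?eqxx // andbT.
apply/orP; left; apply: contraNneq nxP => eq_rk.
by rewrite (stl x y).
Qed.

Lemma matching_swap (E A B : finType) (l : E -> A) (r : E -> B) (M : {set E}) :
  matching r l M -> matching l r M.
Proof. by case. Qed.

Lemma sub_strict_rank (E V : finType) (p : E -> V) (rk : E -> nat) (F F' : {set E}) :
  F' \subset F -> strict_rank p rk F -> strict_rank p rk F'.
Proof. by move=> /subsetP sF st x y /sF xF /sF yF; apply: st. Qed.

(* A stable matching of [M1 :|: M2] in which left ends prefer [M2] and right ends prefer [M1]. *)
Lemma mendelsohn_dulmage (E A B : finType) (l : E -> A) (r : E -> B) (M1 M2 : {set E}) :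
  matching l r M1 -> matching l r M2 ->
  exists M : {set E}, [/\ M \subset M1 :|: M2, matching l r M,
    l @: M1 \subset l @: M & r @: M2 \subset r @: M].
Proof.
move=> [injl1 injr1] [injl2 injr2].
have [||M [sM mM domM]] := @stable_matching E A B l r
    (fun x => x \notin M2 : nat) (fun x => x \notin M1 : nat) (M1 :|: M2).
- move=> x y /setUP xU /setUP yU lxy.
  have [x2|x2] := boolP (x \in M2); have [y2|y2] := boolP (y \in M2) => //= _; first exact: injl2.
  by apply: injl1 => //; [case: xU | case: yU] => //; rewrite ?(negPf x2) ?(negPf y2).
- move=> x y /setUP xU /setUP yU rxy.
  have [x1|x1] := boolP (x \in M1); have [y1|y1] := boolP (y \in M1) => //= _; first exact: injr1.
  by apply: injr2 => //; [case: xU | case: yU] => //; rewrite ?(negPf x1) ?(negPf y1).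
(* An edge of [M1] has rank 0 at its right end, so it can only be dominated at its left end; dually
   for [M2]. *)
exists M; split=> //; apply/subsetP => _ /imsetP[x xMi ->].
  have [/imset_f-> //|nxM] := boolP (x \in M).
  have [|y yM /[!inE]] := domM x _ nxM; first by rewrite inE xMi.
  by rewrite xMi /= ltn0 !andbF orbF => /and3P[_ /eqP <- _]; apply: imset_f.
have [/imset_f-> //|nxM] := boolP (x \in M).
have [|y yM /[!inE]] := domM x _ nxM; first by rewrite inE xMi orbT.
by rewrite xMi /= ltn0 !andbF => /and3P[_ /eqP <- _]; apply: imset_f.
Qed.

(** * Matchings adapted to the degrees *)

Lemma card_incident_sum (E V : finType) (p : E -> V) (F : {set E}) (W : {set V}) :
  #|[set x in F | p x \in W]| = \sum_(v in W) #|incident p F v|.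
Proof.
rewrite -sum1_card (partition_big p (mem W)) /=; last by move=> x /[!inE] /andP[].
apply: eq_bigr => v vW; rewrite -sum1_card; apply: eq_bigl => x; rewrite !inE.
by have [->|_] := eqVneq (p x) v; rewrite ?vW ?andbT ?andbF.
Qed.

(** Double counting: [k * #|X|] edges leave [X], and each neighbour receives at most [k] of them. *)
Lemma hall_max_degree (E A B : finType) (l : E -> A) (r : E -> B) (F : {set E})
    (k : nat) (X : {set A}) :
  0 < k -> (forall a, a \in X -> #|incident l F a| = k) ->
  (forall b, #|incident r F b| <= k) -> #|X| <= #|nbrs l r F X|.
Proof.
move=> k_gt0 degX degB; rewrite -(leq_pmul2r k_gt0).
apply: (@leq_trans #|[set x in F | l x \in X]|).
  by rewrite card_incident_sum (eq_bigr _ degX) sum_nat_const.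
apply: (@leq_trans #|[set x in F | r x \in nbrs l r F X]|).
  apply/subset_leq_card/subsetP => x /[!inE] /andP[xF lx]; rewrite xF.
  by apply: imset_f; rewrite inE xF.
by rewrite card_incident_sum -sum_nat_const; apply: leq_sum.
Qed.

(** By the last clause, at an edge covered only on the left, removing [M] lowers the larger end
    degree. *)
Definition top_matching (E A B : finType) (l : E -> A) (r : E -> B) (F M : {set E}) : Prop :=
  [/\ M \subset F, M != set0, matching l r M &
    forall x, x \in F -> l x \in l @: M -> r x \notin r @: M ->
      #|incident r F (r x)| < #|incident l F (l x)|].

(** One matching covers [X], another the degree-[k] neighbours of [X]; merging them leaves only
    neighbours of degree below [k] uncovered. *)
Lemma top_matching_of_set (E A B : finType) (l : E -> A) (r : E -> B) (F : {set E})
    (k : nat) (X : {set A}) :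
  0 < k -> X != set0 -> (forall a, a \in X -> #|incident l F a| = k) ->
  (forall b, #|incident r F b| <= k) ->
  (forall Z : {set B}, Z \subset nbrs l r F X :&: [set b | #|incident r F b| == k] ->
     #|Z| <= #|nbrs r l [set x in F | l x \in X] Z|) ->
  exists M : {set E}, top_matching l r F M.
Proof.
move=> k_gt0 X0 degX degB hallY; pose F0 := [set x in F | l x \in X].
have nbrsF0 (X' : {set A}) : X' \subset X -> nbrs l r F0 X' = nbrs l r F X'.
  move=> /subsetP sX; rewrite /nbrs.
  suff -> : [set x in F0 | l x \in X'] = [set x in F | l x \in X'] by [].
  apply/setP => x; rewrite !inE.
  by case: (boolP (l x \in X')) => [/sX->|_]; rewrite ?andbT ?andbF.
have [|M1 [sM1 mM1 lM1]] := @hall E A B l r F0 X.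
  move=> X' sX'; rewrite nbrsF0 //; apply: (@hall_max_degree _ _ _ _ _ _ k) => //.
  by move=> a /(subsetP sX'); apply: degX.
have [M2 [sM2 /matching_swap mM2 rM2]] := hall hallY.
have [M [sM mM lM rM]] := mendelsohn_dulmage mM1 mM2.
have sMF0 : M \subset F0 by apply: subset_trans sM _; rewrite subUset sM1.
have lMX a : a \in l @: M -> a \in X.
  by case/imsetP => x /(subsetP sMF0) /[!inE] /andP[_ ?] ->.
exists M; split=> //.
- by apply: subset_trans sMF0 _; apply/subsetP => x /[!inE] /andP[].
- case/set0Pn: X0 => a; rewrite -lM1 => /(subsetP lM) /imsetP[x xM _].
  by apply/set0Pn; exists x.
move=> x xF /lMX lxX nrx; rewrite (degX _ lxX) ltn_neqAle degB andbT.
apply: contra nrx => degx; apply: (subsetP rM); rewrite rM2 !inE degx andbT.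
by apply: imset_f; rewrite inE xF.
Qed.

(* Let [k] be the maximum degree and [N X] the degree-[k] neighbours of a set [X] of left
   vertices of degree [k].  A nonempty [X] maximizing [#|X| - #|N X|] can be covered together
   with all of [N X], unless [#|X| < #|N X|] for every such [X]; in that case all right
   vertices of degree [k] play the role of [X]. *)
Lemma exists_top_matching (E A B : finType) (l : E -> A) (r : E -> B) (F : {set E}) :
  F != set0 ->
  (exists M : {set E}, top_matching l r F M) \/ (exists M : {set E}, top_matching r l F M).
Proof.
case/set0Pn => x0 x0F.
pose k := maxn (\max_a #|incident l F a|) (\max_b #|incident r F b|).
have degA a : #|incident l F a| <= k.
  by rewrite leq_max (leq_bigmax (F := fun a => #|incident l F a|)).
have degB b : #|incident r F b| <= k.
  by rewrite leq_max (leq_bigmax (F := fun b => #|incident r F b|)) orbT.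
have k_gt0 : 0 < k.
  by apply: leq_trans (degA (l x0)); apply/card_gt0P; exists x0; rewrite inE x0F /=.
pose AM := [set a | #|incident l F a| == k]; pose BM := [set b | #|incident r F b| == k].
pose N (X : {set A}) := nbrs l r F X :&: BM.
pose P := [pred X : {set A} | [&& X != set0, X \subset AM & #|N X| <= #|X|]].
have [/existsP[X1 PX1]|noX] := boolP [exists X, P X].
  (* Adding [#|B|] keeps the subtraction from truncating. *)
  left; have [X /and3P[X0 sX leX] maxX] := @arg_maxnP _ X1 P
    (fun X => #|X| + #|B| - #|N X|) PX1.
  apply: (@top_matching_of_set _ _ _ _ _ _ k X) => // [a aX|Z sZ].
    by apply/eqP; have := subsetP sX a aX; rewrite inE.
  set NZ := nbrs r l _ Z.
  have sNZ : NZ \subset X by apply/subsetP => _ /imsetP[x /[!inE] /andP[/andP[_ ?] _] ->].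
  (* Vertices of [Z] have all their neighbours in [X] inside [NZ], so removing [NZ] from [X] frees
     all of [Z]. If [#|NZ| < #|Z|], a nonempty [X :\: NZ] would contradict maximality. *)
  have NX' : #|N (X :\: NZ)| + #|Z| <= #|N X|.
    rewrite -(cardsID Z (N X)) addnC leq_add //.
      by apply/subset_leq_card; rewrite subsetI sZ subxx.
    apply/subset_leq_card/subsetP => b; rewrite !inE => /andP[/imsetP[x] /[!inE]].
    case/and3P => xF nx lx -> ->; rewrite andbT; apply/andP; split; last first.
      by apply: imset_f; rewrite inE xF.
    by apply: contra nx => rx; apply: imset_f; rewrite !inE xF lx rx.
  have cX := cardsID NZ X; rewrite (setIidPr sNZ) in cX.
  have cB : #|N X| <= #|B| := max_card _.
  have cB' : #|N (X :\: NZ)| <= #|B| := max_card _.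
  have [X'0|X'0] := eqVneq (X :\: NZ) set0; first by rewrite X'0 cards0 in cX; lia.
  have [leX'|ltX'] := leqP #|N (X :\: NZ)| #|X :\: NZ|; last by lia.
  have := maxX (X :\: NZ); rewrite /P /= X'0 leX' andbT (subset_trans (subsetDl _ _) sX).
  by move=> /(_ isT); lia.
have ltN X : X != set0 -> X \subset AM -> #|X| < #|N X|.
  move=> X0 sX; rewrite ltnNge; apply: contra noX => leX; apply/existsP.
  by exists X; rewrite /= X0 sX.
right; apply: (@top_matching_of_set _ _ _ _ _ _ k BM) => // [|b /[!inE] /eqP //|Z sZ].
  (* If no left vertex has degree [k], some right vertex attains it; otherwise [AM] has neighbours
     in [BM]. *)
  have [AM0|/ltN/(_ (subxx _))] := eqVneq AM set0; last first.
    by case: (eqVneq BM set0) => // BM0; rewrite /N BM0 setI0 cards0.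
  have cA : 0 < #|A| by apply/card_gt0P; exists (l x0).
  have cB : 0 < #|B| by apply/card_gt0P; exists (r x0).
  have [a maxa] := eq_bigmax (fun a => #|incident l F a|) cA.
  have [b maxb] := eq_bigmax (fun b => #|incident r F b|) cB.
  have ka : #|incident l F a| != k.
    by apply/negP => ka; have /setP/(_ a) := AM0; rewrite !inE ka.
  apply/set0Pn; exists b; rewrite inE; move: ka (degA a) (degB b).
  by rewrite /k maxa maxb; lia.
have [->|Z0] := eqVneq Z set0; first by rewrite cards0.
have sZA : Z \subset AM by apply: subset_trans sZ (subsetIr _ _).
apply: leq_trans (ltnW (ltN Z Z0 sZA)) (subset_leq_card _).
apply/subsetP => _ /setIP[/imsetP[x /[!inE] /andP[xF lx] ->] rx].
by apply: imset_f; rewrite !inE xF rx.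
Qed.

(** * Rankings obtained by peeling off matchings *)

Definition bkw_ranking (E A B : finType) (l : E -> A) (r : E -> B) (F : {set E})
    (rl rr : E -> nat) : Prop :=
  [/\ strict_rank l rl F, strict_rank r rr F &
    forall x, x \in F -> #|better l rl F x| + #|better r rr F x| <
      maxn #|incident l F (l x)| #|incident r F (r x)|].

(** An edge outside [M] gains a better neighbour only if its left end is covered. Then its larger
    end degree grows too: both ends gain an edge, or the uncovered right end has the smaller
    degree. *)
Lemma extend_ranking (E A B : finType) (l : E -> A) (r : E -> B) (F M : {set E})
    (rl rr : E -> nat) :
  top_matching l r F M -> bkw_ranking l r (F :\: M) rl rr ->
  exists rl' rr' : E -> nat, bkw_ranking l r F rl' rr'.
Proof.
move=> [sM _ [injl injr] topM] [stl str out].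
pose big := (\max_x rr x).+1.
have ltbig x : rr x < big by rewrite ltnS (leq_bigmax (F := rr)).
exists (fun x => if x \in M then 0 else (rl x).+1), (fun x => if x \in M then big else rr x).
split.
- move=> x y xF yF lxy; case: ifP => xM; case: ifP => yM // eq_rk; first exact: injl.
  by case: eq_rk => eq_rk; apply: stl; rewrite ?inE ?xM ?yM.
- move=> x y xF yF rxy; case: ifP => xM; case: ifP => yM // eq_rk; first exact: injr.
  + by have := ltbig y; rewrite eq_rk ltnn.
  + by have := ltbig x; rewrite eq_rk ltnn.
  by apply: str; rewrite ?inE ?xM ?yM.
move=> x xF; set bl := better l _ F x; set br := better r _ F x.
have [xM|xM] := boolP (x \in M).
  (* An edge of [M] is beaten only at its right end, and not by itself. *)
  have -> : bl = set0 by apply/setP => y; rewrite !inE xM ltn0 !andbF.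
  rewrite cards0 leq_max; apply/orP; right; apply: proper_card; apply/properP; split.
    by apply/subsetP => y /[!inE] /and3P[-> ->].
  by exists x; rewrite !inE ?xF ?eqxx //= xM ltnn.
have /out : x \in F :\: M by rewrite inE xM.
have -> : br = better r rr (F :\: M) x.
  apply/setP => y; rewrite !inE (negPf xM); case: (boolP (y \in M)) => // yM.
  by rewrite ltnNge (ltnW (ltbig x)) !andbF.
set ol := better l rl _ x; set il := incident l _ _; set ir := incident r _ _.
have split_l : #|bl| <= #|ol| + #|[set y in M | l y == l x]|.
  rewrite -cardsUI; apply: leq_trans (leq_addr _ _); apply/subset_leq_card/subsetP => y.
  rewrite /bl /ol !inE (negPf xM); case: (y \in M) => /and3P[-> -> lt] //=.
  by rewrite orbF.
have incE (V : finType) (p : E -> V) v :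
    #|incident p F v| = #|incident p (F :\: M) v| + #|[set y in M | p y == v]|.
  rewrite -(cardsID M (incident p F v)) addnC; congr (_ + _); apply: eq_card => y.
    by rewrite !inE andbA.
  rewrite !inE.
  by case: (boolP (y \in M)) => [/(subsetP sM)->|_]; rewrite ?andbF ?andbT.
have card_at (V : finType) (p : E -> V) : {in M &, injective p} ->
    #|[set y in M | p y == p x]| = (p x \in p @: M).
  move=> injp; case: imsetP => [[y yM ->]|nM] /=.
    rewrite -(cards1 y); apply: eq_card => z; rewrite !inE.
    apply/andP/eqP => [[zM /eqP]|->]; last by rewrite eqxx.
    exact: injp.
  apply/eqP; rewrite cards_eq0; apply/eqP/setP => y; rewrite !inE.
  by apply/andP=> -[yM /eqP py]; apply: nM; exists y.
have := topM x xF; have := incE _ l (l x); have := incE _ r (r x).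
rewrite -/il -/ir !card_at // => incr incl; move: split_l; rewrite card_at //.
move: incr incl; case: (l x \in l @: M); case: (r x \in r @: M) => /= ? ? ?.
- by move=> _; lia.
- by move=> /(_ isT isT); lia.
- by move=> _; lia.
by move=> _; lia.
Qed.

Lemma bkw_ranking_swap (E A B : finType) (l : E -> A) (r : E -> B) (F : {set E})
    (rl rr : E -> nat) :
  bkw_ranking l r F rl rr -> bkw_ranking r l F rr rl.
Proof. by case=> stl str out; split=> // x xF; rewrite addnC maxnC out. Qed.

Lemma exists_bkw_ranking (E A B : finType) (l : E -> A) (r : E -> B) (F : {set E}) :
  exists rl rr : E -> nat, bkw_ranking l r F rl rr.
Proof.
have [n] := ubnP #|F|; elim: n F => // n IHn F ltFn.
have [->|F0] := eqVneq F set0.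
  by exists (fun=> 0), (fun=> 0); split=> x; [move=> y| move=> y|]; rewrite inE.
have ltM (M : {set E}) : M \subset F -> M != set0 -> #|F :\: M| < n.
  move=> sM; rewrite -card_gt0 => M0; have := cardsID M F; rewrite (setIidPr sM); lia.
have [[M topM]|[M topM]] := exists_top_matching l r F0.
  have [sM M0 _ _] := topM; have [rl [rr rk]] := IHn _ (ltM _ sM M0).
  exact: extend_ranking topM rk.
have [sM M0 _ _] := topM; have [rl [rr rk]] := IHn _ (ltM _ sM M0).
have [rl' [rr' rk']] := extend_ranking topM (bkw_ranking_swap rk).
by exists rr', rl'; apply: bkw_ranking_swap.
Qed.

(** * List edge colouring *)

(* Galvin's argument: a stable matching of the edges admitting a given colour can receive
   that colour, since every other such edge loses one of its better edges. *)
Lemma list_edge_coloring_of_ranking (E A B C : finType) (l : E -> A) (r : E -> B)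
    (F : {set E}) (rl rr : E -> nat) (L : E -> {set C}) (c0 : C) :
  strict_rank l rl F -> strict_rank r rr F ->
  (forall x, x \in F -> #|better l rl F x| + #|better r rr F x| < #|L x|) ->
  exists c : E -> C, (forall x, x \in F -> c x \in L x) /\
    (forall x y, x \in F -> y \in F -> x != y -> l x = l y \/ r x = r y -> c x != c y).
Proof.
have [n] := ubnP #|F|; elim: n F L => // n IHn F L ltFn stl str out.
have [->|[x0 x0F]] := set_0Vmem F.
  by exists (fun=> c0); split=> x; [|move=> y]; rewrite inE.
have /card_gt0P[g gL] : 0 < #|L x0| by apply: leq_ltn_trans (out _ x0F).
pose G := [set x in F | g \in L x].
have sG : G \subset F by apply/subsetP => x /[!inE] /andP[].
have [M [sM [injl injr] domM]] :=
  stable_matching (sub_strict_rank sG stl) (sub_strict_rank sG str).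
have sMF := subset_trans sM sG.
have M0 : 0 < #|M|.
  have [x0M|x0M] := boolP (x0 \in M); first by apply/card_gt0P; exists x0.
  have [|y yM _] := domM x0 _ x0M; first by rewrite inE x0F.
  by apply/card_gt0P; exists y.
have sD : F :\: M \subset F := subsetDl _ _.
have ltD : #|F :\: M| < n by have := cardsID M F; rewrite (setIidPr sMF); lia.
have sub_better (V : finType) (p : E -> V) rk x : better p rk (F :\: M) x \subset better p rk F x.
  by apply/subsetP => y /[!inE] /andP[/andP[_ ->]].
have drop (V : finType) (p : E -> V) rk x y : y \in M -> y \in better p rk F x ->
    #|better p rk (F :\: M) x| < #|better p rk F x|.
  move=> yM yb; apply: proper_card; apply/properP; split=> //.
  by exists y => //; rewrite !inE yM.
have [|c [cL cP]] := IHn _ (fun x => L x :\ g) ltD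
    (sub_strict_rank sD stl) (sub_strict_rank sD str).
  move=> x /setDP[xF xM]; have := out x xF; rewrite (cardsD1 g (L x)).
  have := subset_leq_card (sub_better _ l rl x); have := subset_leq_card (sub_better _ r rr x).
  have [gx|_] := boolP (g \in L x); last by lia.
  have [|y yM dom] := domM x _ xM; first by rewrite inE xF.
  have yF := subsetP sMF y yM.
  case/orP: dom => /[!inE] /andP[_ dom].
    by have := @drop _ l rl x y yM; rewrite inE yF => /(_ dom); lia.
  by have := @drop _ r rr x y yM; rewrite inE yF => /(_ dom); lia.
exists (fun x => if x \in M then g else c x); split=> [x xF|x y xF yF nxy adj].
  have [xM|xM] := boolP (x \in M); first by have := subsetP sM x xM; rewrite inE => /andP[].
  by have := cL x; rewrite !inE xM xF => /(_ isT) /andP[].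
have cg z : z \in F -> z \notin M -> c z != g.
  by move=> zF zM; have := cL z; rewrite !inE zM zF => /(_ isT) /andP[].
have [xM|xM] := boolP (x \in M); have [yM|yM] := boolP (y \in M).
- by case/eqP: nxy; case: adj => ?; [apply: injl | apply: injr].
- by rewrite eq_sym cg.
- by rewrite cg.
by apply: cP; rewrite // inE ?xM ?yM.
Qed.

(** * Extension of the total colouring *)

Lemma card_palette_avoiding (k : nat) (s : seq nat) :
  k <= #|[set j : 'I_k.+1 | in_palette k j && (val j \notin s)]| + size s.
Proof.
rewrite -[X in X <= _](size_iota 1 k) -(count_predC (mem s)) addnC -!size_filter.
apply: leq_add; last first.
  apply: uniq_leq_size; first by rewrite filter_uniq ?iota_uniq.
  by move=> j; rewrite mem_filter => /andP[].
set J := [set j | _]; rewrite cardE -(size_map val); apply: uniq_leq_size.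
  by rewrite filter_uniq ?iota_uniq.
move=> j; rewrite mem_filter mem_iota /= => /andP[js jk].
have ltj : j < k.+1 by lia.
apply/mapP; exists (Ordinal ltj) => //; rewrite mem_enum inE /= js andbT /in_palette; lia.
Qed.

Lemma extend_vertex_coloring (T : finType) (e : rel T) (k : nat) (S : {set T})
    (col : T -> nat) :
  simple_graph e -> maxdeg e < k -> (forall v, v \in S -> in_palette k (col v)) ->
  (forall u v, u \in S -> v \in S -> e u v -> col u != col v) ->
  exists col' : T -> nat, [/\ forall v, v \in S -> col' v = col v,
    forall v, in_palette k (col' v) & forall u v, e u v -> col' u != col' v].
Proof.
move=> [symE irrE] ltk.
have [n] := ubnP #|~: S|; elim: n S col => // n IHn S col ltSn pal prop.
have [S0|[v]] := set_0Vmem (~: S).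
  have inS v : v \in S by have /setP/(_ v) := S0; rewrite !inE => /negbFE.
  by exists col; split=> [//|v|u v euv]; [apply: pal | apply: prop].
rewrite inE => vS.
(* Avoiding the provisional colours of neighbours outside [S] too is harmless, as [k] exceeds the
   whole degree. *)
have /card_gt0P[j] : 0 < #|[set j : 'I_k.+1 | in_palette k j &&
    (val j \notin [seq col w | w in [set w | e v w]])]|.
  have := card_palette_avoiding k [seq col w | w in [set w | e v w]].
  have : deg e v <= maxdeg e := leq_bigmax v.
  by rewrite size_image /deg; lia.
rewrite inE => /andP[palj nj].
have nbr_j w : e v w -> col w != j.
  move=> evw; apply: contraNneq nj => colw; apply/imageP.
  by exists w; rewrite ?inE.
have [|u uS|u w uS wS euw|col' [agree pal' prop']] :=
  IHn (v |: S) (fun u => if u == v then val j else col u).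
- by move: ltSn; rewrite setCU setIC -setDE (cardsD1 v (~: S)) inE vS; lia.
- by move: uS; rewrite !inE; case: eqVneq => //= _; apply: pal.
- move: uS wS euw; rewrite !inE; case: eqVneq => [->|_]; case: eqVneq => [->|_] /=.
  + by rewrite irrE.
  + by move=> _ _ evw; rewrite eq_sym nbr_j.
  + by move=> _ _; rewrite symE => /nbr_j.
  + exact: prop.
exists col'; split=> // u uS; rewrite agree ?inE ?uS ?orbT //.
by case: eqVneq uS vS => // -> ->.
Qed.

Theorem theorem4p4 (T : finType) (e : rel T) (VH : {set T}) (eH : rel T) (d : nat)
  (col : T -> nat) (cole : T -> T -> nat) :
  simple_graph e -> planar e -> bipartite e ->
  subgraph e VH eH -> maxdeg_le VH eH d ->
  total_coloring_in e VH eH (maxdeg e + d + 4) col cole ->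
  exists (col' : T -> nat) (cole' : T -> T -> nat),
    total_coloring e (maxdeg e + d + 4) col' cole' /\
    (forall v, v \in VH -> col' v = col v) /\
    (forall u v, eH u v -> cole' u v = cole u v).
Proof.
move=> simE _ [part partP] [symH subH] degH [palV [palH [propV [propH totH]]]].
have [symE _] := simE; set k := maxdeg e + d + 4 in palV palH *.
have ltk : maxdeg e < k by rewrite /k; lia.
have [col' [agree pal' prop']] := extend_vertex_coloring simE ltk palV propV.
pose NH u := [set w | eH u w].
have leNH u : #|NH u| <= d.
  have [uV|uV] := boolP (u \in VH); last first.
    suff -> : NH u = set0 by rewrite cards0.
    by apply/setP => w; rewrite !inE; apply/negP => /subH[]; rewrite (negPf uV).
  apply: leq_trans (degH u uV); apply/subset_leq_card/subsetP => w; rewrite !inE => euw.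
  by have [_ -> _] := subH _ _ euw.
(* Each edge outside [H] occurs once, directed out of the side [part], so [fst] and [snd] are its
   end maps. *)
pose F := [set x : T * T | [&& e x.1 x.2, part x.1 & ~~ eH x.1 x.2]].
have degE u : #|[set w | e u w && ~~ eH u w]| + #|NH u| <= maxdeg e.
  apply: leq_trans (leq_bigmax u); rewrite /deg -(cardsID (NH u) [set w | e u w]) addnC.
  apply: leq_add; apply/subset_leq_card/subsetP => w; rewrite !inE; last by rewrite andbC.
  by move=> uw; rewrite uw andbT; have [] := subH _ _ uw.
have deg1 u : #|incident fst F u| + #|NH u| <= maxdeg e.
  apply: leq_trans (degE u); rewrite leq_add2r -(card_in_imset (f := snd)).
    apply/subset_leq_card/subsetP => _ /imsetP[[a b] /[!inE] /= + ->].
    by case/andP=> /and3P[eab _ nH] /eqP <-; rewrite eab.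
  by move=> [a b] [a' b'] /[!inE] /= /andP[_ /eqP->] /andP[_ /eqP->] ->.
have deg2 u : #|incident snd F u| + #|NH u| <= maxdeg e.
  apply: leq_trans (degE u); rewrite leq_add2r -(card_in_imset (f := fst)).
    apply/subset_leq_card/subsetP => _ /imsetP[[a b] /[!inE] /= + ->].
    by case/andP=> /and3P[eab _ nH] /eqP <-; rewrite symE eab symH.
  by move=> [a b] [a' b'] /[!inE] /= /andP[_ /eqP->] /andP[_ /eqP->] ->.
pose taken u := [seq cole u w | w in NH u].
pose L (x : T * T) := [set j : 'I_k.+1 | in_palette k j &&
  (val j \notin [:: col' x.1, col' x.2 & taken x.1 ++ taken x.2])].
have [rl [rr [stl str out]]] := exists_bkw_ranking fst snd F.
have [|c [cL cP]] := list_edge_coloring_of_ranking (L := L) ord0 stl str.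
  move=> x xF; apply: leq_trans (out x xF) _.
  (* At either end, [deg1] or [deg2] bounds the degree plus [h] there by [Delta], and the other [h]
     is at most [d]. *)
  have := card_palette_avoiding k [:: col' x.1, col' x.2 & taken x.1 ++ taken x.2].
  rewrite -/(L x) /= size_cat !size_image.
  have := deg1 x.1; have := deg2 x.2; have := leNH x.1; have := leNH x.2.
  move: #|L x| #|NH x.1| #|NH x.2| #|incident _ _ x.1| #|incident _ _ x.2|; lia.
(* [q] picks the representative of an edge in [F]. *)
pose q u v := if part u then (u, v) else (v, u).
have qF u v : e u v -> ~~ eH u v -> q u v \in F.
  rewrite /q => euv nH; have := partP _ _ euv.
  by case: ifP => pu; rewrite inE /= ?pu ?euv // symE euv symH nH; case: (part v).
have qsym u v : e u v -> q u v = q v u.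
  by move=> /partP; rewrite /q; case: (part u); case: (part v).
have qL u v : e u v -> ~~ eH u v -> [/\ in_palette k (c (q u v)),
    val (c (q u v)) != col' u & forall w, eH u w -> val (c (q u v)) != cole u w].
  move=> euv nH; have := cL _ (qF _ _ euv nH); set j := c _; rewrite inE => /andP[palj].
  rewrite !inE mem_cat !negb_or => /and4P[j1 j2 t1 t2]; split=> // [|w uw].
    by move: j1 j2; rewrite /q; case: (part u).
  have : val j \notin taken u by move: t1 t2; rewrite /q; case: (part u).
  by apply: contraNneq => cw; apply/imageP; exists w; rewrite ?inE.
exists col', (fun u v => if eH u v then cole u v else val (c (q u v))).
split; last by split=> // u v ->.
split=> //; split.
  move=> u v euv; rewrite symH; case: (boolP (eH v u)) => [|]; rewrite symH => uv.
    exact: palH.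
  by have [-> _ _] := qL _ _ euv uv; rewrite (qsym _ _ euv).
split=> //; split.
  move=> u v w euv euw nvw; case: ifPn => uv; case: ifPn => uw.
  - exact: propH.
  - by have [_ _ /(_ _ uv)] := qL _ _ euw uw; rewrite eq_sym.
  - by have [_ _ /(_ _ uw)] := qL _ _ euv uv.
  apply: cP; rewrite ?qF // /q.
    by case: (part u); rewrite xpair_eqE eqxx ?andbT.
  by case: (part u); [left | right].
move=> u v euv; case: ifPn => uv; last by have [] := qL _ _ euv uv.
have [uV _ _] := subH _ _ uv; rewrite agree //; exact: totH.
Qed.
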